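(* Let $\mathbb{K}$ be a field and let $m,k$ be integers with $1\le k\le m-1$. If $\mathrm{char}(\mathbb{K})$ does not divide $m(m-1)\cdots(m-k+1)$, then the ring extension $$\mathbb{K}[\Pi_1,\dots,\Pi_{m-k}]\hookrightarrow\mathbb{K}[\Pi_1,\dots,\Pi_m]/\big(\mathrm{sDisc}_0(f_{\boldsymbol X}),\dots,\mathrm{sDisc}_{k-1}(f_{\boldsymbol X})\big)$$ is integral.
   Context: $\Pi_1,\dots,\Pi_m$ are the elementary symmetric polynomials of $\mathbb{K}[X_1,\dots,X_m]$ (algebraically independent over $\mathbb{K}$). For $f_{\boldsymbol X}:=(T-X_1)\cdots(T-X_m)$ and $0\le j\le m-1$, the generic $j$th subdiscriminant is $$\mathrm{sDisc}_j(f_{\boldsymbol X}):=\sum_{I\subset\{1,\dots,m\},\ |I|=m-j}\ \prod_{i,l\in I,\ i<l}(X_i-X_l)^2,$$ a symmetric polynomial in $X_1,\dots,X_m$, regarded as an element of the polynomial ring $\mathbb{K}[\Pi_1,\dots,\Pi_m]$. (A field of characteristic $0$ is understood to satisfy the non-divisibility condition.) *)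

(* Defs.v *)
From HB Require Import structures.
From mathcomp Require Import all_boot all_fingroup all_algebra.
From mathcomp Require Import generic_quotient ring_quotient.
From mathcomp Require Import boolp.
From mathcomp Require Import mpoly.

Set Implicit Arguments.
Unset Strict Implicit.
Unset Printing Implicit Defensive.

Import GRing.Theory.
Local Open Scope ring_scope.
Local Open Scope quotient_scope.

Section Subdiscriminants.
Variables (K : fieldType) (m : nat).

Definition sDisc (j : nat) : {mpoly K[m]} :=
  \sum_(I : {set 'I_m} | #|I| == (m - j)%N)
    \prod_(i in I) \prod_(l in I | (i < l)%N) ('X_i - 'X_l) ^+ 2.

(* The variable of index i (starting from 0) of {mpoly K[m]} now stands for   *)
(* the elementary symmetric polynomial Pi_(i+1): sDiscPi j is the polynomial  *)
(* in Pi_1, ..., Pi_m that represents sDisc j, see sDiscPiE and sDiscPi_uniq. *)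
Definition sDiscPi (j : nat) : {mpoly K[m]} := symf (sDisc j).

Lemma prod_pairs_perm (s : 'S_m) (F : 'I_m -> 'I_m -> {mpoly K[m]})
    (I : {set 'I_m}) : (forall i l, F i l = F l i) ->
  \prod_(i in I) \prod_(l in I | (i < l)%N) F (s i) (s l) =
  \prod_(i in s @: I) \prod_(l in s @: I | (i < l)%N) F i l.
Proof.
move=> Fsym; rewrite !pair_big_dep /=.
pose srt (q : 'I_m * 'I_m) := if (q.1 < q.2)%N then q else (q.2, q.1).
pose h q := srt (s q.1, s q.2); pose g q := srt ((s^-1)%g q.1, (s^-1)%g q.2).
have memE i : (s i \in s @: I) = (i \in I) by rewrite mem_imset //; apply: perm_inj.
have memV i : ((s^-1)%g i \in I) = (i \in s @: I).
  by rewrite -{2}[i](permKV s) memE.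
rewrite [RHS](reindex_onto h g) /=; last first.
  case=> i l /= /and3P[_ _ il]; rewrite /h /g /srt /=.
  by case: (ltnP ((s^-1)%g i)) => _ /=; rewrite !permKV ?il // ltnNge ltnW.
apply: eq_big => [[i l]|[i l]] /=; last first.
  by move=> _; rewrite /h /srt /=; case: ifP.
have hE : [&& (h (i, l)).1 \in s @: I, (h (i, l)).2 \in s @: I
   & ((h (i, l)).1 < (h (i, l)).2)%N] = [&& i \in I, l \in I & i != l].
  rewrite /h /srt /=; case: ifPn => /= [sil|]; rewrite !memE.
    by rewrite sil; case: (eqVneq i l) sil => [->|_ _]; first by rewrite ltnn.
  rewrite -leqNgt leq_eqVlt => sli; rewrite andbCA; congr (_ && (_ && _)).
  case: (eqVneq i l) sli => [->|il]; first by rewrite ltnn.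
  case/predU1P => [/val_inj/perm_inj e|-> //]; by rewrite e eqxx in il.
rewrite hE /g /h /srt /=.
have [-> | ] := eqVneq i l; first by rewrite ltnn !andbF.
move=> nil; rewrite andbT -andbA; congr (_ && (_ && _)).
have {nil} nil : (i : nat) != l by [].
case: (ltnP (s i) (s l)) => _ /=; rewrite !permK /=; case: ltngtP nil => // il _;
  rewrite ?eqxx //; apply/esym/eqP => -[e _]; by rewrite e ltnn in il.
Qed.

Lemma msym_var (s : 'S_m) (i : 'I_m) : msym s ('X_i : {mpoly K[m]}) = 'X_(s i).
Proof. by rewrite /msym mmapX mmap1U. Qed.

Lemma sDisc_sym j : sDisc j \is symmetric.
Proof.
apply/issymP => s; rewrite /sDisc raddf_sum /=.
rewrite [RHS](reindex_inj (imset_inj (@perm_inj _ s))) /=.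
apply: eq_big => [I|I _]; first by rewrite card_imset //; apply: perm_inj.
rewrite -prod_pairs_perm; last by move=> i l; rewrite -sqrrN opprB.
rewrite rmorph_prod; apply: eq_bigr => i _; rewrite rmorph_prod.
by apply: eq_bigr => l _; rewrite rmorphXn rmorphB /= !msym_var.
Qed.

Lemma sDiscPiE j : sDiscPi j \mPo [tuple mesym m K i.+1 | i < m] = sDisc j.
Proof. by rewrite -symfP // sDisc_sym. Qed.

Lemma sDiscPi_uniq j (p : {mpoly K[m]}) :
  p \mPo [tuple mesym m K i.+1 | i < m] = sDisc j -> p = sDiscPi j.
Proof. by rewrite -sDiscPiE => /msym_fundamental_un. Qed.

End Subdiscriminants.

Section Quotient.
Variables (K : fieldType) (m k : nat).

Definition sDisc_ideal : pred {mpoly K[m]} := fun p =>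
  `[< exists c : 'I_k -> {mpoly K[m]}, p = \sum_(j < k) c j * sDiscPi K m j >].

Lemma sDiscPi_eval0 (j : nat) : (j.+1 < m)%N -> (sDiscPi K m j).@[fun=> 0] = 0.
Proof.
move=> jm; have := congr1 (meval (fun=> 0)) (sDiscPiE K m j).
rewrite comp_mpoly_meval.
have -> : (sDiscPi K m j).@[fun i => (tnth [tuple mesym m K i.+1 | i < m] i).@[fun=> 0]]
   = (sDiscPi K m j).@[fun=> 0].
  apply: meval_eq => i; rewrite tnth_mktuple /mesym raddf_sum big1 //= => h /eqP ch.
  have /card_gt0P[x xh] : (0 < #|h|)%N by rewrite ch.
  by rewrite rmorph_prod (bigD1 x) //= mevalXU mul0r.
move->; rewrite /sDisc raddf_sum big1 //= => I /eqP cI.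
have /card_gt1P[x [y [xI yI xy]]] : (1 < #|I|)%N by rewrite cI ltn_subRL addn1.
wlog ltxy : x y xI yI xy / (x < y)%N.
  move=> W; case: (ltngtP x y) => [|yx|/val_inj e]; first exact: W.
    by apply: (W y x) => //; rewrite eq_sym.
  by rewrite e eqxx in xy.
rewrite rmorph_prod (bigD1 x) //= rmorph_prod (bigD1 y) ?yI //=.
by rewrite rmorphXn rmorphB /= !mevalXU subrr expr0n !mul0r.
Qed.

Lemma sDisc_ideal_closed : (1 <= k <= m - 1)%N -> idealr_closed sDisc_ideal.
Proof.
move=> /andP[k0 km]; split.
- apply/asboolP; exists (fun=> 0); by rewrite big1 // => j _; rewrite mul0r.
- apply/asboolP => -[c /(congr1 (meval (fun=> 0)))].
  rewrite rmorph1 raddf_sum big1 /=; first by move/eqP; rewrite oner_eq0.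
  move=> j _; rewrite rmorphM /= sDiscPi_eval0 ?mulr0 //.
  rewrite subn1 in km; have jk := leq_trans (ltn_ord j) km.
  by case: (m) jk.
- move=> a p q /asboolP[c ->] /asboolP[d ->]; apply/asboolP.
  exists (fun j => a * c j + d j); rewrite mulr_sumr -big_split /=.
  by apply: eq_bigr => j _; rewrite mulrDl mulrA.
Qed.

Hypothesis hk : (1 <= k <= m - 1)%N.

Definition sDisc_idealr : idealr {mpoly K[m]} :=
  HB.pack sDisc_ideal
    (isIdealr.Build {mpoly K[m]} sDisc_ideal (sDisc_ideal_closed hk)).

Definition sDisc_quot : comNzRingType := {ideal_quot sDisc_idealr}.

Definition Pi_incl (p : {mpoly K[m - k]}) : {mpoly K[m]} :=
  p \mPo [tuple 'X_(widen_ord (leq_subr k m) i) | i < m - k].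

HB.instance Definition _ := GRing.RMorphism.copy Pi_incl
  (comp_mpoly [tuple 'X_(widen_ord (leq_subr k m) i) | i < m - k]).

Definition Pi_to_quot (p : {mpoly K[m - k]}) : sDisc_quot :=
  \pi_{ideal_quot sDisc_idealr} (Pi_incl p).

HB.instance Definition _ := GRing.RMorphism.copy Pi_to_quot
  (\pi_{ideal_quot sDisc_idealr} \o Pi_incl).

End Quotient.

(* Main.v *)
From HB Require Import structures.
Require Import Defs.
From mathcomp Require Import all_boot all_fingroup all_algebra.
From mathcomp Require Import generic_quotient ring_quotient boolp.
From mathcomp Require Import mpoly.

Set Implicit Arguments.
Unset Strict Implicit.
Unset Printing Implicit Defensive.

Import GRing.Theory.
Local Open Scope ring_scope.
Local Open Scope quotient_scope.

(* By Cauchy-Binet, sDisc_(m-r) is the r x r Hankel determinant of the power  *)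
(* sums p_(i+j). Modulo Pi_1, ..., Pi_(r-1), Newton's identities give         *)
(* p_l = 0 for 0 < l < r and p_r = +-r Pi_r, so that the determinant becomes  *)
(* +-m (r Pi_r)^(r-1). Hence, for m - k < r <= m,                             *)
(*   sDisc_(m-r) = u_r Pi_r^(r-1) + (element of (Pi_1, ..., Pi_(r-1)))        *)
(* with u_r a nonzero scalar. For an order in which the smaller indices       *)
(* dominate, Pi_r^(r-1) is the lowest term, so the products                   *)
(*   Pi_1^b_1 ... Pi_(m-k)^b_(m-k) prod_r sDisc_(m-r)^c_r Pi_r^a_r,           *)
(* with a_r < r - 1, have pairwise distinct lowest monomials, which exhaust   *)
(* all the monomials. Weighted homogeneity makes the change of basis          *)
(* invertible: these products form a K-basis of K[Pi_1, ..., Pi_m]. The       *)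
(* ideal is spanned by those with c <> 0, so the quotient is free of finite   *)
(* rank over K[Pi_1, ..., Pi_(m-k)].                                          *)

(** The linear map [mlinext bvec] sends each monomial in the Pi's to the product of the adapted
    basis with that lowest monomial. [bvec_lowest] makes it triangular, and it is bijective by
    [mlinext_lowest_inj] and [mlinext_lowest_surj]. The input is [mcut_sDiscPi], the computation of
    sDisc_(m-r) modulo Pi_1, ..., Pi_(r-1).

    This map turns multiplication by Pi_r^(r-1) into multiplication by sDisc_(m-r) for r > m - k
    ([mlinext_bvecM]), and fixes K[Pi_1, ..., Pi_(m-k)] pointwise ([mlinext_bvec_Pi_incl]). It
    therefore carries the monomial ideal of the Pi_r^(r-1) onto the ideal of subdiscriminants, and
    both claims reduce to the monomial ideal. Since r - 1 > 0, setting Pi_r = 0 for r > m - k kills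
    that ideal but no nonzero element of K[Pi_1, ..., Pi_(m-k)], whence injectivity. The monomials
    with small exponents span the quotient, whence integrality by the determinant trick
    ([integralRange_fin_span]). *)

Section CauchyBinet.
Variable R : comPzRingType.

(** Multilinearity in the rows: row [i] of the product is a combination of the rows of [B] with
    coefficients [A i j]. *)
Lemma det_mulmx_sum_ffun (r m : nat) (A : 'M[R]_(r, m)) (B : 'M[R]_(m, r)) :
  \det (A *m B) =
  \sum_(f : {ffun 'I_r -> 'I_m}) \prod_i A i (f i) * \det (rowsub f B).
Proof.
pose AB (s : 'S_r) i j := A i j * B j (s i).
transitivity (\sum_(f : {ffun 'I_r -> 'I_m})
                \sum_(s : 'S_r) (-1) ^+ s * \prod_i AB s i (f i)).
  rewrite exchange_big; apply: eq_bigr => /= s _; rewrite -big_distrr /=.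
  congr (_ * _); rewrite -(bigA_distr_bigA (AB s)) /=.
  by apply: eq_bigr => x _; rewrite mxE.
apply: eq_bigr => f _; rewrite big_distrr /=; apply: eq_bigr => s _.
rewrite mulrCA big_split //=; congr (_ * (_ * _)).
by apply: eq_bigr => x _; rewrite mxE.
Qed.

Variables (r m : nat) (A : 'M[R]_(r, m)) (B : 'M[R]_(m, r)).

(** Each such [f] is [g] composed with a unique permutation, whose sign comes out of the minor of
    [B]; the signed sum is the Leibniz expansion of the minor of [A]. *)
Lemma det_mulmx_image (I : {set 'I_m}) (g : 'I_r -> 'I_m) :
    injective g -> [set g x | x in 'I_r] = I ->
  \sum_(f : {ffun 'I_r -> 'I_m} | injectiveb f && ([set f x | x in 'I_r] == I))
     \prod_i A i (f i) * \det (rowsub f B)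
  = \det (colsub g A) * \det (rowsub g B).
Proof.
move=> injg gI.
pose comp (s : 'S_r) : {ffun 'I_r -> 'I_m} := [ffun x => g (s x)].
have comp_inj : injective comp.
  move=> s t /ffunP est; apply/permP => x; apply: injg.
  by have := est x; rewrite !ffunE.
have im_comp s : [set comp s x | x in 'I_r] = I.
  rewrite -gI; apply/setP => y; apply/imsetP/imsetP => -[x _ ->].
    by exists (s x); rewrite ?ffunE.
  by exists ((s^-1)%g x); rewrite ?ffunE ?permKV.
have compP (f : {ffun 'I_r -> 'I_m}) :
    injectiveb f && ([set f x | x in 'I_r] == I) -> exists s, comp s = f.
  move=> /andP[/injectiveP injf /eqP fI].
  have /fin_all_exists[s sE] x : exists y, f x = g y.
    have : f x \in I by rewrite -fI imset_f.
    by rewrite -gI => /imsetP[y _ ->]; exists y.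
  have injs : injective s by move=> x y exy; apply: injf; rewrite !sE exy.
  by exists (perm injs); apply/ffunP => x; rewrite ffunE permE sE.
transitivity (\sum_(f in [set comp s | s : 'S_r])
     \prod_i A i (f i) * \det (rowsub f B)).
  apply: eq_bigl => f; apply/idP/imsetP => [/compP[s <-]|[s _ ->]].
    by exists s.
  rewrite im_comp eqxx andbT; apply/injectiveP => x y.
  by rewrite !ffunE => /injg/perm_inj.
rewrite big_imset /=; last by move=> s t _ _ /comp_inj.
rewrite big_distrl /=; apply: eq_bigr => s _.
have -> : rowsub (comp s) B = row_perm s (rowsub g B).
  by apply/matrixP => i j; rewrite !mxE ffunE.
rewrite row_permE det_mulmx det_perm [in RHS]mulrAC mulrC.
by congr (_ * _); apply: eq_bigr => i _; rewrite mxE ffunE.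
Qed.

(** Non-injective maps repeat a row and contribute 0; the others are grouped by image. Any
    enumeration [g I] will do, as changing it multiplies both minors by the same sign. *)
Lemma Cauchy_Binet (g : {set 'I_m} -> 'I_r -> 'I_m) :
    (forall I : {set 'I_m}, #|I| = r ->
       injective (g I) /\ [set g I x | x in 'I_r] = I) ->
  \det (A *m B) = \sum_(I : {set 'I_m} | #|I| == r)
     \det (colsub (g I) A) * \det (rowsub (g I) B).
Proof.
move=> gP; rewrite det_mulmx_sum_ffun.
rewrite (bigID (fun f : {ffun 'I_r -> 'I_m} => injectiveb f)) /=.
rewrite addrC big1 ?add0r => [|f /injectivePn[i1 [i2 Di12 Ef12]]]; last first.
  by rewrite (determinant_alternate Di12) ?mulr0 // => j; rewrite !mxE Ef12.
rewrite (partition_big (fun f : {ffun 'I_r -> 'I_m} => [set f x | x in 'I_r])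
           (fun I : {set 'I_m} => #|I| == r)) /=.
  by apply: eq_bigr => I /eqP/gP[injg gI]; apply: det_mulmx_image.
by move=> f /injectiveP injf; rewrite card_imset // card_ord.
Qed.

End CauchyBinet.

(** * Increasing enumeration of a finite set of indices *)

Section IncreasingEnum.
Variables (m r : nat) (m_gt0 : (0 < m)%N).

Definition set_nth_ord (I : {set 'I_m}) (x : 'I_r) : 'I_m :=
  nth (Ordinal m_gt0) (enum I) x.

Variables (I : {set 'I_m}) (cardI : #|I| = r).

Lemma set_nth_ord_inj : injective (set_nth_ord I).
Proof.
move=> x y /eqP; rewrite nth_uniq ?enum_uniq -?cardE ?cardI // => /eqP.
exact: val_inj.
Qed.

Lemma imset_set_nth_ord : [set set_nth_ord I x | x in 'I_r] = I.
Proof.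
apply/eqP; rewrite eqEcard card_imset ?card_ord ?cardI ?leqnn ?andbT;
  last exact: set_nth_ord_inj.
apply/subsetP => _ /imsetP[x _ ->].
by rewrite -mem_enum mem_nth // -cardE cardI.
Qed.

Lemma ltn_set_nth_ord (x y : 'I_r) :
  (set_nth_ord I x < set_nth_ord I y)%N = (x < y)%N.
Proof.
have srt : sorted ltn (map val (enum I)).
  rewrite /enum_mem sorted_map sorted_filter //.
    by move=> i j l; apply: ltn_trans.
  by rewrite -sorted_map -enumT val_enum_ord iota_ltn_sorted.
have inE' z : z \in gtn (size (map val (enum I))) = (z < r)%N.
  by rewrite inE size_map -cardE cardI.
have mono (a b : 'I_r) : (a < b)%N -> (set_nth_ord I a < set_nth_ord I b)%N.
  move=> ab; have := sorted_ltn_nth ltn_trans 0%N srt.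
  move=> /(_ a b); rewrite !inE' !ltn_ord => /(_ isT isT ab) /=.
  by rewrite !(nth_map (Ordinal m_gt0)) // -cardE cardI.
apply/idP/idP => [|/mono //]; apply: contraTT; rewrite -!leqNgt leq_eqVlt.
by case/predU1P => [/val_inj -> //|/mono/ltnW].
Qed.

Lemma prod_pairs_set_nth_ord (R : comPzRingType) (F : 'I_m -> 'I_m -> R) :
  \prod_(i in I) \prod_(l in I | (i < l)%N) F i l =
  \prod_(x < r) \prod_(y < r | (x < y)%N) F (set_nth_ord I x) (set_nth_ord I y).
Proof.
have reidx (P : pred 'I_m) (G : 'I_m -> R) : 
    \prod_(i in I | P i) G i =
    \prod_(x < r | P (set_nth_ord I x)) G (set_nth_ord I x).
  rewrite -{1}imset_set_nth_ord big_mkcondr big_imset /=.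
    by rewrite -big_mkcond.
  by move=> x y _ _; apply: set_nth_ord_inj.
transitivity (\prod_(i in I | true) \prod_(l in I | (i < l)%N) F i l).
  by apply: eq_bigl => i; rewrite andbT.
rewrite reidx; apply: eq_bigr => x _; rewrite reidx.
by apply: eq_bigl => y; rewrite ltn_set_nth_ord.
Qed.

End IncreasingEnum.

(** * Subdiscriminants as Hankel determinants of power sums *)

Section PowerSums.
Variables (K : fieldType) (m : nat).

Definition psum (l : nat) : {mpoly K[m]} := \sum_(i < m) 'X_i ^+ l.

Lemma psum_sym l : psum l \is symmetric.
Proof.
apply/issymP => s; rewrite /psum raddf_sum /=.
rewrite [RHS](reindex_inj (@perm_inj _ s)) /=.
by apply: eq_bigr => i _; rewrite rmorphXn /= msym_var.
Qed.

(** The Hankel matrix is V V^T for the r x m Vandermonde matrix V, and the squares of the maximal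
    minors of V are the summands of the subdiscriminant. *)
Lemma sDisc_Hankel (r : nat) : (0 < m)%N -> (r <= m)%N ->
  sDisc K m (m - r) = \det (\matrix_(i < r, j < r) psum (i + j)).
Proof.
move=> m_gt0 rm.
pose V : 'M_(r, m) := Vandermonde r (\row_(i < m) ('X_i : {mpoly K[m]})).
have -> : \matrix_(i < r, j < r) psum (i + j) = V *m V^T.
  apply/matrixP => i j; rewrite !mxE; apply: eq_bigr => l _.
  by rewrite !mxE exprD.
rewrite (@Cauchy_Binet _ _ _ _ _ (@set_nth_ord m r m_gt0)); last first.
  by move=> I cI; split; [apply: set_nth_ord_inj | apply: imset_set_nth_ord].
rewrite /sDisc subKn //; apply: eq_bigr => I /eqP cI.
rewrite (prod_pairs_set_nth_ord m_gt0 cI).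
pose g := @set_nth_ord m r m_gt0 I.
have -> : rowsub g V^T = (colsub g V)^T by apply/matrixP => i j; rewrite !mxE.
rewrite det_tr -expr2.
have -> : colsub g V = Vandermonde r (\row_(i < r) 'X_(g i)).
  by apply/matrixP => i j; rewrite !mxE.
rewrite det_Vandermonde -prodrXl; apply: eq_bigr => x _.
rewrite -prodrXl; apply: eq_bigr => y _.
by rewrite !mxE -sqrrN opprB.
Qed.

End PowerSums.

(** * Newton's identities *)

Section Newton.

Lemma deriv_prod (R : comNzRingType) (n : nat) (F : 'I_n -> {poly R}) :
  (\prod_i F i)^`() = \sum_i (F i)^`() * \prod_(j | j != i) F j.
Proof.
elim: n F => [|n IHn] F; first by rewrite !big_ord0 -polyC1 derivC.
rewrite big_ord_recl derivM IHn big_ord_recl /=.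
rewrite [X in _ = _ * X + _]big_mkcond big_ord_recl /= mul1r; congr (_ + _).
rewrite mulr_sumr; apply: eq_bigr => i _; rewrite mulrCA; congr (_ * _).
rewrite [RHS]big_mkcond big_ord_recl /= [in LHS]big_mkcond; congr (_ * _).
Qed.

Variables (R : idomainType) (n : nat) (x : 'I_n -> R).
Let f : {poly R} := \prod_i ('X - (x i)%:P).
Let p l := \sum_i x i ^+ l.

(* Horner's scheme for the division of [f] by ['X - (x i)%:P]. *)
Lemma coef_prod_but_one (i : 'I_n) (l : nat) : (l < n)%N ->
  (\prod_(j | j != i) ('X - (x j)%:P))`_(n.-1 - l) =
  \sum_(a < l.+1) f`_(n - a) * x i ^+ (l - a).
Proof.
set q := \prod_(j | _) _.
have fE : f = 'X * q - x i *: q.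
  by rewrite /f (bigD1 i) //= mulrBl mul_polyC.
have n_gt0 : (0 < n)%N := leq_ltn_trans (leq0n i) (ltn_ord i).
have szq : (size q <= n)%N.
  rewrite /q -big_filter size_prod_XsubC size_filter -sum1_count.
  by rewrite (sum1_card (predC1 i)) cardC1 card_ord prednK.
elim: l => [|l IHl] lt_ln.
  rewrite big_ord1 !subn0 mulr1 fE coefB coefXM coefZ (nth_default _ szq) mulr0.
  by rewrite subr0 eqn0Ngt n_gt0.
rewrite big_ord_recr /= subnn expr0 mulr1.
have -> : \sum_(a < l.+1) f`_(n - a) * x i ^+ (l.+1 - a) =
    x i * \sum_(a < l.+1) f`_(n - a) * x i ^+ (l - a).
  rewrite mulr_sumr; apply: eq_bigr => a _; rewrite mulrCA -exprS subSn //.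
  by rewrite -ltnS.
rewrite -IHl; last exact: ltnW.
rewrite fE coefB coefXM coefZ; have -> : (n - l.+1 == 0)%N = false.
  by apply/negbTE; rewrite subn_eq0 -ltnNge.
have -> : (n - l.+1)%N = (n.-1 - l)%N by case: (n) lt_ln.
by rewrite addrC subrK -subnS.
Qed.

(** For [l < n], sum over [i] the coefficients of f / (X - x_i): these quotients add up to f'. For
    [l = n], the inner sum is f evaluated at its root x_i. *)
Lemma Newton_identity (l : nat) : (l <= n)%N ->
  \sum_(a < l.+1) f`_(n - a) * p (l - a) = (n - l)%:R * f`_(n - l).
Proof.
move=> le_ln.
have -> : \sum_(a < l.+1) f`_(n - a) * p (l - a) =
    \sum_i \sum_(a < l.+1) f`_(n - a) * x i ^+ (l - a).
  by rewrite exchange_big; apply: eq_bigr => a _; rewrite -mulr_sumr.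
have := le_ln; rewrite leq_eqVlt => /predU1P[->|lt_ln]; last first.
  rewrite (eq_bigr _ (fun i _ => esym (coef_prod_but_one i lt_ln))) -coef_sum.
  have -> : \sum_i \prod_(j | j != i) ('X - (x j)%:P) = f^`().
    by rewrite deriv_prod; apply: eq_bigr => i _; rewrite derivXsubC mul1r.
  rewrite coef_deriv mulr_natl.
  suff -> : (n.-1 - l).+1 = (n - l)%N by [].
  have n_gt0 := leq_ltn_trans (leq0n l) lt_ln.
  by rewrite -subSn ?(prednK n_gt0) // -ltnS prednK.
rewrite subnn mul0r big1 // => i _.
transitivity f.[x i]; last first.
  by rewrite /f (bigD1 i) //= hornerM hornerXsubC subrr mul0r.
have szf : (size f <= n.+1)%N.
  by rewrite /f size_prod_XsubC -sum1_size sum1_card card_ord.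
rewrite (horner_coef_wide _ szf) [RHS](reindex_inj rev_ord_inj) /=.
by apply: eq_bigr => a _; rewrite subSS.
Qed.

End Newton.

(** * The same identities in the coordinates Pi *)

Section LeadingTerm.
Variables (K : fieldType) (m : nat).

Local Notation esyms := [tuple mesym m K i.+1 | i < m].

Lemma coef_prod_XsubX (a : nat) : (a <= m)%N ->
  (\prod_(i < m) ('X - ('X_i : {mpoly K[m]})%:P))`_(m - a) =
  (-1) ^+ a * mesym m K a.
Proof.
rewrite -ltnS => lt_am; pose cs := [tuple ('X_i : {mpoly K[m]}) | i < m].
have csE i : tnth cs i = 'X_i by rewrite tnth_mktuple.
have -> : \prod_(i < m) ('X - ('X_i : {mpoly K[m]})%:P) =
    \prod_(c <- cs) ('X - c%:P).
  by rewrite big_tuple; apply: eq_bigr => i _; rewrite csE.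
rewrite (mroots_coeff cs (Ordinal lt_am)) /=; congr (_ * _).
rewrite /mesym raddf_sum /=; apply: eq_bigr => h _.
by rewrite rmorph_prod; apply: eq_bigr => i _; rewrite /= mevalXU csE.
Qed.

Definition psumPi (l : nat) : {mpoly K[m]} := symf (psum K m l).

Lemma psumPiE l : psumPi l \mPo esyms = psum K m l.
Proof. by rewrite -symfP // psum_sym. Qed.

Lemma psumPi0 : psumPi 0 = m%:R.
Proof.
apply: (@msym_fundamental_un _ K); rewrite psumPiE rmorph_nat /psum.
by under eq_bigr do rewrite expr0; rewrite sumr_const card_ord.
Qed.

(* The coefficient of [T ^ (m - a)] in [(T - X_1) ... (T - X_m)].             *)
Definition Pi_coef (a : nat) : {mpoly K[m]} := symf ((-1) ^+ a * mesym m K a).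

Lemma Pi_coefE a : Pi_coef a \mPo esyms = (-1) ^+ a * mesym m K a.
Proof. by rewrite -symfP // rpredM ?mesym_sym // rpredX // rpredN rpred1. Qed.

Lemma Pi_coefS (i : 'I_m) : Pi_coef i.+1 = (-1) ^+ i.+1 * 'X_i.
Proof.
apply: (@msym_fundamental_un _ K); rewrite Pi_coefE rmorphM rmorphXn rmorphN1 /=.
by rewrite comp_mpolyXU -tnth_nth tnth_mktuple.
Qed.

(** Since p_0 = m, the term [a = l] of the identity cancels the m in the factor m - l. *)
Lemma Newton_psumPi (l : nat) : (0 < l <= m)%N ->
  psumPi l = - (\sum_(1 <= a < l) Pi_coef a * psumPi (l - a))
             - l%:R * Pi_coef l.
Proof.
move=> /andP[l_gt0 lm]; apply: (@msym_fundamental_un _ K).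
rewrite psumPiE rmorphB rmorphN rmorphM rmorph_nat rmorph_sum /= Pi_coefE.
under eq_bigr do rewrite rmorphM /= Pi_coefE psumPiE.
have := Newton_identity (fun i : 'I_m => ('X_i : {mpoly K[m]})) lm.
have -> : \sum_(a < l.+1) (\prod_i ('X - ('X_i : {mpoly K[m]})%:P))`_(m - a)
             * (\sum_i 'X_i ^+ (l - a))
    = \sum_(0 <= a < l.+1) (-1) ^+ a * mesym m K a * psum K m (l - a).
  rewrite big_mkord; apply: eq_bigr => a _; rewrite coef_prod_XsubX //.
  by rewrite (leq_trans _ lm) // -ltnS.
rewrite coef_prod_XsubX // big_nat_recr //= big_ltn // subnn subn0 mesym0E.
rewrite expr0 !mul1r natrB // mulrBl.
have -> : psum K m 0 = m%:R.
  by rewrite /psum; under eq_bigr do rewrite expr0; rewrite sumr_const card_ord.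
rewrite [_ * m%:R]mulrC => /(canRL (addrK _))/(canRL (addrK _)) ->.
by rewrite (addrC (m%:R * _)) addrK addrC.
Qed.

Lemma sDiscPi_Hankel (r : nat) : (0 < m)%N -> (r <= m)%N ->
  sDiscPi K m (m - r) = \det (\matrix_(i < r, j < r) psumPi (i + j)).
Proof.
move=> m_gt0 rm; apply: (@msym_fundamental_un _ K).
rewrite sDiscPiE sDisc_Hankel // -det_map_mx; congr (\det _).
by apply/matrixP => i j; rewrite !mxE /= psumPiE.
Qed.

End LeadingTerm.

(** * A sparse Hankel determinant *)

Section AntiTriangular.
Variable R : comPzRingType.

(* Reversing the columns other than the first one makes the Hankel matrix     *)
(* lower triangular.                                                          *)
Lemma det_Hankel_sparse (r : nat) (s : nat -> R) :
    (forall l, (0 < l < r.+1)%N -> s l = 0) ->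
  exists b : bool, \det (\matrix_(i < r.+1, j < r.+1) s (i + j)%N) =
    (-1) ^+ b * (s 0%N * s r.+1 ^+ r).
Proof.
move=> s0.
(* Off column 0, entry [(i, h j)] has index i + (r + 1 - j): it is r + 1 on the diagonal and lies
   strictly between 0 and r + 1 above it. *)
pose h (j : 'I_r.+1) : 'I_r.+1 := inord (if j == 0%N :> nat then 0%N else r.+1 - j)%N.
have hE (j : 'I_r.+1) : h j = (if j == 0%N :> nat then 0%N else r.+1 - j)%N :> nat.
  rewrite inordK //; case: ifPn => // j0.
  by rewrite ltn_subrL lt0n j0.
have hK : involutive h.
  move=> j; apply: val_inj; rewrite /= !hE.
  have lt_j := ltn_ord j; case: (posnP j) => [-> //|j_gt0].
  by rewrite subn_eq0 leqNgt lt_j /= subKn // ltnW.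
pose t := perm (can_inj hK).
pose M := \matrix_(i < r.+1, j < r.+1) s (i + j)%N.
have : \det (col_perm t M) = s 0%N * s r.+1 ^+ r.
  rewrite det_trig.
    rewrite big_ord_recl !mxE permE hE /=; congr (_ * _).
    rewrite -[r in _ ^+ r]card_ord -prodr_const; apply: eq_bigr => i _.
    by rewrite !mxE permE hE /= /bump /= add1n subnKC // ltnS ltnW.
  apply/is_trig_mxP => i j ij; rewrite !mxE permE hE.
  have j_gt0 := leq_ltn_trans (leq0n i) ij.
  rewrite eqn0Ngt j_gt0 /=; apply: s0.
  rewrite addnBA ?[(j <= _)%N]ltnW //.
  by rewrite subn_gt0 ltn_addl //= ltn_subLR ?ltn_add2r // (leq_trans (ltnW (ltn_ord j))) ?leq_addl.
rewrite col_permE det_mulmx det_perm => <-.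
by exists (t : bool); rewrite -/M odd_permV mulrCA -signr_addb addbb expr0 mulr1.
Qed.
End AntiTriangular.

(** * Linear maps prescribed on monomials *)

Section MpolyLinearExtension.
Variables (K : fieldType) (m : nat) (V : lmodType K) (F : 'X_{1..m} -> V).

Definition mlinext (p : {mpoly K[m]}) : V := \sum_(e <- msupp p) p@_e *: F e.

Lemma mlinextE (p : {mpoly K[m]}) (r : seq 'X_{1..m}) :
    uniq r -> {subset msupp p <= r} ->
  mlinext p = \sum_(e <- r) p@_e *: F e.
Proof.
move=> r_uniq sub; rewrite [RHS](bigID (mem (msupp p))) /=.
rewrite [X in _ + X]big1 ?addr0 => [|e /memN_msupp_eq0 ->]; last by rewrite scale0r.
rewrite -big_filter; apply: perm_big; apply: uniq_perm => [||e].
- exact: msupp_uniq.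
- exact: filter_uniq.
by rewrite mem_filter; apply/idP/andP => [ep|[]//]; split=> //; apply: sub.
Qed.

Lemma mlinext_is_linear : linear mlinext.
Proof.
move=> c p q; pose r := undup (msupp p ++ msupp q ++ msupp (c *: p + q)).
have r_uniq : uniq r := undup_uniq _.
rewrite !(@mlinextE _ r) //; last 3 first.
- by move=> e ep; rewrite mem_undup !mem_cat ep ?orbT.
- by move=> e ep; rewrite mem_undup !mem_cat ep ?orbT.
- by move=> e ep; rewrite mem_undup !mem_cat ep ?orbT.
rewrite scaler_sumr -big_split /=; apply: eq_bigr => e _.
by rewrite mcoeffD mcoeffZ scalerDl scalerA.
Qed.

HB.instance Definition _ :=
  GRing.isLinear.Build K {mpoly K[m]} V _ mlinext mlinext_is_linear.

Lemma mlinextX e : mlinext 'X_[e] = F e.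
Proof. by rewrite /mlinext msuppX big_seq1 mcoeffX eqxx scale1r. Qed.

End MpolyLinearExtension.

(** * Families triangular for the monomial basis *)

Section Triangular.
Variables (K : fieldType) (m : nat) (wt om : measure m).
Implicit Types (p q : {mpoly K[m]}) (e : 'X_{1..m}).

(** [om] plays the monomial order; the upper bound on [wt] keeps the reduction to higher terms
    finite. *)
Definition mbounded (W b : nat) p :=
  forall e, e \in msupp p -> (wt e <= W)%N /\ (b <= om e)%N.

Lemma mboundedD W b p q :
  mbounded W b p -> mbounded W b q -> mbounded W b (p + q).
Proof.
by move=> Hp Hq e /msuppD_le; rewrite mem_cat => /orP[/Hp|/Hq].
Qed.

Lemma mboundedZ W b c p : mbounded W b p -> mbounded W b (c *: p).
Proof. by move=> Hp e /msuppZ_le/Hp. Qed.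

Lemma mboundedX e : mbounded (wt e) (om e) 'X_[e].
Proof. by move=> e' /mem_msuppXP <-. Qed.

Lemma mboundedM W b W' b' p q : mbounded W b p -> mbounded W' b' q ->
  mbounded (W + W') (b + b') (p * q).
Proof.
move=> Hp Hq e /msuppM_le/allpairsP[[e1 e2] /= [/Hp[w1 o1] /Hq[w2 o2] ->]].
by rewrite !mfD !leq_add.
Qed.

Lemma mbounded_leq W b b' p : (b' <= b)%N -> mbounded W b p -> mbounded W b' p.
Proof. by move=> le_b Hp e /Hp[? /(leq_trans le_b)]. Qed.

Definition mlowest e p :=
  exists2 u : K, u != 0 & mbounded (wt e) (om e).+1 (p - u *: 'X_[e]).

Lemma mlowestX e : mlowest e 'X_[e].
Proof.
exists 1; first exact: oner_neq0.
by rewrite scale1r subrr => e'; rewrite msupp0.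
Qed.

Lemma mlowestM e e' p q :
  mlowest e p -> mlowest e' q -> mlowest (e + e') (p * q).
Proof.
move=> [u u0 Hp] [v v0 Hq]; exists (u * v); first by rewrite mulf_neq0.
have -> : p * q - (u * v) *: 'X_[e + e'] =
    (p - u *: 'X_[e]) * q + (u *: 'X_[e]) * (q - v *: 'X_[e']).
  by rewrite mulrBl mulrBr addrA subrK -scalerAl -scalerAr scalerA mpolyXD.
have Hq' : mbounded (wt e') (om e') q.
  rewrite -(subrK (v *: 'X_[e']) q); apply: mboundedD.
    exact: mbounded_leq Hq.
  exact/mboundedZ/mboundedX.
rewrite !mfD; apply: mboundedD; first by rewrite -addSn; apply: mboundedM.
by rewrite -addnS; apply: mboundedM => //; apply/mboundedZ/mboundedX.
Qed.

Lemma mlowest1 : mlowest 0 1.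
Proof. by rewrite -mpolyX0; apply: mlowestX. Qed.

Lemma mlowestXn e p n : mlowest e p -> mlowest (e *+ n) (p ^+ n).
Proof.
move=> Hp; elim: n => [|n IHn]; first by rewrite expr0 mulm0n; apply: mlowest1.
by rewrite exprS mulmS; apply: mlowestM.
Qed.

Variable B : 'X_{1..m} -> {mpoly K[m]}.
Hypothesis B_lowest : forall e, mlowest e (B e).

(** At an exponent [e] of [p] with minimal [om], only [B e] contributes to the coefficient of the
    image; ties in [om] are harmless, as the other terms of [B e'] lie strictly higher. *)
Lemma mlinext_lowest_inj p : mlinext B p = 0 -> p = 0.
Proof.
move=> Bp0; apply/eqP; apply: contraT => p_neq0; exfalso.
have [e ep emin] : exists2 e, e \in msupp p &
    forall e', e' \in msupp p -> (om e <= om e')%N.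
  have ex_om : exists n, has (fun e => om e == n) (msupp p).
    exists (om (mlead p)); apply/hasP; exists (mlead p) => //.
    exact: mlead_supp.
  case: (ex_minnP ex_om) => n /hasP[e ep /eqP <-] nmin.
  by exists e => // e' e'p; apply: nmin; apply/hasP; exists e'.
have := congr1 (mcoeff e) Bp0; rewrite mcoeff0 /mlinext raddf_sum /=.
rewrite (bigD1_seq e) ?msupp_uniq //= big_seq_cond big1 => [|e' /andP[e'p e'e]].
  rewrite addr0 mcoeffZ; have [u u0 Hu] := B_lowest e.
  have -> : (B e)@_e = u.
    have /memN_msupp_eq0 : e \notin msupp (B e - u *: 'X_[e]).
      by apply/negP => /Hu[_]; rewrite ltnn.
    by rewrite mcoeffB mcoeffZ mcoeffX eqxx mulr1 => /eqP; rewrite subr_eq0 => /eqP.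
  by move/eqP; rewrite mulf_eq0 (negbTE u0) orbF mcoeff_eq0 ep.
rewrite mcoeffZ; have [u u0 Hu] := B_lowest e'.
have /memN_msupp_eq0 : e \notin msupp (B e' - u *: 'X_[e']).
  by apply/negP => /Hu[_]; rewrite ltnNge emin.
rewrite mcoeffB mcoeffZ mcoeffX (negbTE e'e) mulr0 subr0 => ->.
by rewrite mulr0.
Qed.

Variable C : nat.
Hypothesis om_le : forall e, (om e <= C * wt e)%N.

(** A monomial is rewritten as a multiple of [B e] plus terms with larger [om] and no larger [wt].
    As [om] is bounded by [C * wt], the difference [C * wt e - om e] strictly decreases. *)
Lemma mlinext_lowest_surj p : exists q, mlinext B q = p.
Proof.
pose im p := exists q, mlinext B q = p.
have imD q q' : im q -> im q' -> im (q + q').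
  by move=> [a <-] [b <-]; exists (a + b); rewrite raddfD.
have imZ c q : im q -> im (c *: q).
  by move=> [a <-]; exists (c *: a); rewrite linearZ.
have imS q : (forall e, e \in msupp q -> im 'X_[e]) -> im q.
  move=> H; rewrite [q]mpolyE big_seq; apply: big_ind => //.
    by exists 0; rewrite raddf0.
  by move=> e /H; apply: imZ.
apply: (imS p) => e _; have [n] := ubnP (C * wt e - om e)%N.
elim: n e => // n IHn e; rewrite ltnS => le_n.
have [u u0 Hu] := B_lowest e.
suff : im (u *: 'X_[e]).
  by move/(imZ u^-1); rewrite scalerA mulVf // scale1r.
have -> : u *: 'X_[e] = B e + (-1) *: (B e - u *: 'X_[e]).
  by rewrite scaleN1r opprB addrC subrK.
apply: imD; first by exists 'X_[e]; rewrite mlinextX.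
apply/imZ/imS => e' /Hu[we' oe']; apply: IHn; apply: leq_trans le_n.
have oC : (om e' <= C * wt e)%N.
  by rewrite (leq_trans (om_le e')) // leq_mul2l we' orbT.
apply: (@leq_ltn_trans (C * wt e - om e')%N).
  by rewrite leq_sub2r // leq_mul2l we' orbT.
by rewrite ltn_sub2l // (leq_trans oe').
Qed.

End Triangular.

(** * Reduction modulo the variables of small index *)

Section Cut.
Variables (K : fieldType) (m i : nat).

Definition mcut (p : {mpoly K[m]}) : {mpoly K[m]} :=
  p \mPo [tuple (if (a < i)%N then 0 else 'X_a) | a < m].

HB.instance Definition _ := GRing.RMorphism.copy mcut
  (comp_mpoly [tuple (if (a < i)%N then 0 else 'X_a) | a < m]).

Lemma mcutXU (a : 'I_m) : mcut 'X_a = if (a < i)%N then 0 else 'X_a.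
Proof. by rewrite /mcut comp_mpolyXU -tnth_nth tnth_mktuple. Qed.

Lemma mcutZ c p : mcut (c *: p) = c *: mcut p.
Proof. exact: comp_mpolyZ. Qed.

(** The difference lies in the ideal generated by the killed variables. *)
Lemma msupp_mcut p e : e \in msupp (p - mcut p) ->
  exists2 a : 'I_m, (a < i)%N & (0 < e a)%N.
Proof.
have -> : p - mcut p = \sum_(e' <- msupp p) p@_e' *: ('X_[e'] - mcut 'X_[e']).
  have -> : mcut p = \sum_(e' <- msupp p) p@_e' *: mcut 'X_[e'].
    rewrite {1}[p]mpolyE raddf_sum; apply: eq_bigr => e' _.
    exact: mcutZ.
  rewrite {1}[p]mpolyE -sumrB; apply: eq_bigr => e' _.
  by rewrite scalerBr.
move/msupp_sum_le => /flattenP[_ /mapP[e' _ ->]] /msuppZ_le.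
have cutX : mcut 'X_[e'] = \prod_(a < m) mcut 'X_a ^+ e' a.
  rewrite {1}mpolyXE_id rmorph_prod; apply: eq_bigr => a _.
  by rewrite rmorphXn.
have [/existsP[a /andP[ai e'a]]|] :=
    boolP [exists a : 'I_m, (a < i)%N && (0 < e' a)%N].
  rewrite cutX (bigD1 a) //= mcutXU ai expr0n eqn0Ngt e'a mul0r subr0.
  by move/mem_msuppXP <-; exists a.
rewrite negb_exists => /forallP none.
suff -> : mcut 'X_[e'] = 'X_[e'] by rewrite subrr msupp0.
rewrite cutX [RHS]mpolyXE_id; apply: eq_bigr => a _; rewrite mcutXU.
have := none a; rewrite negb_and; case: ltnP => //= _.
by rewrite -eqn0Ngt => /eqP ->.
Qed.

End Cut.

(** * The lowest term of a subdiscriminant *)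

Section LowestTerm.
Variables (K : fieldType) (m : nat).

Lemma dhomog_big_prod (I : Type) (r : seq I) (F : I -> {mpoly K[m]})
    (d : I -> nat) : (forall i, F i \is (d i).-homog) ->
  \prod_(i <- r) F i \is (\sum_(i <- r) d i).-homog.
Proof.
move=> HF; elim: r => [|i r IHr]; first by rewrite !big_nil dhomog1.
by rewrite !big_cons dhomogM.
Qed.

Lemma dhomog_psum l : psum K m l \is l.-homog.
Proof.
apply: rpred_sum => i _.
have := @dhomogMn _ K (@mdeg m) 1 'X_i l; rewrite mul1n; apply.
by rewrite dhomogX /= mdeg1.
Qed.

Lemma dhomog_sDisc (r : nat) : (0 < m)%N -> (r <= m)%N ->
  sDisc K m (m - r) \is (r * r.-1).-homog.
Proof.
move=> m_gt0 rm; rewrite sDisc_Hankel //; apply: rpred_sum => s _.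
rewrite -signr_odd rpredMsign.
have -> : (r * r.-1)%N = (\sum_(i < r) (i + s i))%N.
  rewrite big_split /= -(reindex_inj (F := val) (P := xpredT) (@perm_inj _ s)).
  by rewrite addnn -mul2n -(big_mkord xpredT id) bin2_sum -mul_bin_diag bin1.
by apply: dhomog_big_prod => i; rewrite mxE dhomog_psum.
Qed.

Lemma dhomog_sDiscPi (r : nat) : (0 < m)%N -> (r <= m)%N ->
  sDiscPi K m (m - r) \is (r * r.-1).-homog for (@mnmwgt m).
Proof. by move=> m0 rm; rewrite mwmwgt_homogE sDiscPiE dhomog_sDisc. Qed.

(** After the cut, Newton's recursion keeps only its last term -l c_l, and c_l vanishes for 0 < l <=
    i; the sparse Hankel determinant then applies. *)
Lemma mcut_sDiscPi (i : 'I_m) : m%:R != 0 :> K -> i.+1%:R != 0 :> K ->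
  exists2 u : K, u != 0 &
    mcut i (sDiscPi K m (m - i.+1)) = u *: 'X_[(U_(i) *+ i)%MM].
Proof.
move=> m_neq0 i_neq0.
have m_gt0 : (0 < m)%N := leq_ltn_trans (leq0n i) (ltn_ord i).
pose s l := mcut i (psumPi K m l).
have cut_coef a : (0 < a < i.+1)%N -> mcut i (Pi_coef K m a) = 0.
  case: a => // a /=; rewrite ltnS => ai.
  have am : (a < m)%N := ltn_trans ai (ltn_ord i).
  by rewrite (Pi_coefS _ (Ordinal am)) rmorphM /= mcutXU /= ai mulr0.
have sE l : (0 < l <= i.+1)%N -> s l = - (l%:R * mcut i (Pi_coef K m l)).
  move=> /andP[l_gt0 li]; rewrite /s Newton_psumPi; last first.
    by rewrite l_gt0 (leq_trans li).
  rewrite rmorphB rmorphN rmorph_sum rmorphM rmorph_nat big_nat big1 /=.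
    by rewrite oppr0 add0r.
  move=> a /andP[a_gt0 al]; rewrite rmorphM /= cut_coef ?mul0r //.
  by rewrite a_gt0 (leq_trans al).
have s0 l : (0 < l < i.+1)%N -> s l = 0.
  move=> /andP[l_gt0 li]; rewrite sE ?l_gt0 1?ltnW //.
  by rewrite cut_coef ?l_gt0 // mulr0 oppr0.
have [b detE] := det_Hankel_sparse s0.
(* The factors are the sign of the column permutation, p_0 = m, and the i-th power of the scalar in
   p_(i+1) = -(i+1) (-1)^(i+1) Pi_(i+1). *)
exists ((-1) ^+ b * (m%:R * (- (i.+1%:R * (-1) ^+ i.+1)) ^+ i)).
  by rewrite !mulf_neq0 ?signr_eq0 ?expf_neq0 // oppr_eq0 mulf_neq0 ?signr_eq0.
rewrite sDiscPi_Hankel // -det_map_mx.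
have -> : map_mx (mcut i) (\matrix_(i0 < i.+1, j < i.+1) psumPi K m (i0 + j)) =
    \matrix_(i0 < i.+1, j < i.+1) s (i0 + j)%N.
  by apply/matrixP => x y; rewrite !mxE.
rewrite detE (sE i.+1) ?leqnn // Pi_coefS rmorphM rmorphXn rmorphN1 /= mcutXU ltnn.
rewrite /s psumPi0 rmorph_nat mulrA -mulNr exprMn mpolyXn.
rewrite -mul_mpolyC !(rmorphM, rmorphXn, rmorphN, rmorph_nat, rmorph1) /=.
by rewrite !mulrA.
Qed.

(* A single numerical weight suffices in place of the lexicographic order,    *)
(* because the exponent of ['X_i] in the lowest terms is [i < m].             *)
Definition lexwt (e : 'X_{1..m}) : nat := (\sum_(i < m) e i * m ^ (m - i.+1))%N.

Lemma lexwt0 : lexwt 0 = 0%N.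
Proof. by rewrite /lexwt big1 // => i _; rewrite mnm0E. Qed.

Lemma lexwtD : {morph lexwt : e e' / (e + e')%MM >-> (e + e')%N}.
Proof.
move=> e e'; rewrite /lexwt -big_split /=; apply: eq_bigr => i _.
by rewrite mnmDE mulnDl.
Qed.

HB.instance Definition _ := isMeasure.Build m lexwt lexwt0 lexwtD.

(** Supplies the constant [C] of [mlinext_lowest_surj]. *)
Lemma lexwt_le e : (lexwt e <= m ^ m * mnmwgt e)%N.
Proof.
rewrite /lexwt /mnmwgt big_distrr /=; apply: leq_sum => i _.
have m_gt0 : (0 < m)%N := leq_ltn_trans (leq0n i) (ltn_ord i).
rewrite mulnCA leq_mul2l; apply/orP; right.
apply: (@leq_trans (m ^ m)%N); last by rewrite leq_pmulr.
by rewrite leq_pexp2l ?leq_subr.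
Qed.

Lemma leq_lexwt (e : 'X_{1..m}) (i : 'I_m) : (e i * m ^ (m - i.+1) <= lexwt e)%N.
Proof. by rewrite /lexwt (bigD1 i) //= leq_addr. Qed.

Lemma mf_muln (mf : measure m) e n : mf (e *+ n)%MM = (mf e * n)%N.
Proof.
elim: n => [|n IHn]; first by rewrite mulm0n mf0 muln0.
by rewrite mulmS mfD IHn mulnS.
Qed.

Lemma lexwt1 (i : 'I_m) : lexwt U_(i) = (m ^ (m - i.+1))%N.
Proof.
rewrite /lexwt (bigD1 i) //= mnm1E eqxx mul1n big1 ?addn0 // => j ji.
by rewrite mnm1E eq_sym (negbTE ji).
Qed.

(** The [mnmwgt] bound is homogeneity. Every other monomial contains some ['X_a] with [a < i], so
    its [lexwt] is at least m * m^(m-i-1), which exceeds i * m^(m-i-1). *)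
Lemma sDiscPi_lowest (i : 'I_m) : m%:R != 0 :> K -> i.+1%:R != 0 :> K ->
  mlowest (@mnmwgt m) lexwt (U_(i) *+ i) (sDiscPi K m (m - i.+1)).
Proof.
move=> m_neq0 i_neq0; have [u u0 cutE] := mcut_sDiscPi m_neq0 i_neq0.
have m_gt0 : (0 < m)%N := leq_ltn_trans (leq0n i) (ltn_ord i).
exists u => //; rewrite -cutE => e es; split.
  rewrite mf_muln /= mnmwgt1.
  have := msuppB_le es; rewrite mem_cat => /orP[es'|].
    by have /= -> := dhomog_mf (dhomog_sDiscPi m_gt0 (ltn_ord i)) es'.
  rewrite cutE => /msuppZ_le/mem_msuppXP <-.
  by rewrite mf_muln /= mnmwgt1.
have [a ai ea] := msupp_mcut es.
apply: leq_trans (leq_lexwt e a); rewrite mf_muln /= lexwt1.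
apply: (@leq_trans (m ^ (m - a.+1))%N); last by rewrite leq_pmull.
apply: (@leq_trans (m * m ^ (m - i.+1))%N).
  by rewrite mulnC ltn_mul2r expn_gt0 m_gt0 /=.
by rewrite -expnS leq_pexp2l // -subSn // subSS leq_sub2l.
Qed.

End LowestTerm.

(** Determinant trick: if A is a matrix of multiplication by x on the generators, the adjugate of x
    - A shows that det(x - A) kills every generator, hence 1. So x is a root of the characteristic
    polynomial of A. *)
Lemma integralRange_fin_span (R S : comNzRingType) (f : {rmorphism R -> S})
    (I : finType) (g : I -> S) :
  (forall x, exists c : I -> R, x = \sum_i f (c i) * g i) -> integralRange f.
Proof.
move=> span x.
have [c1 c1E] := span 1.
have /fin_all_exists[c cE] (i : I) := span (x * g i).
pose A := \matrix_(i < #|I|, j < #|I|) c (enum_val i) (enum_val j).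
pose G := \col_(i < #|I|) g (enum_val i).
pose D := x%:M - map_mx f A.
have DG0 : D *m G = 0.
  apply/eqP; rewrite mulmxBl mul_scalar_mx subr_eq0; apply/eqP/colP => i.
  rewrite !mxE cE (reindex _ (onW_bij _ (enum_val_bij I))) /=.
  by apply: eq_bigr => j _; rewrite !mxE.
have detG i : \det D * g i = 0.
  have : \adj D *m (D *m G) = 0 by rewrite DG0 mulmx0.
  rewrite mulmxA mul_adj_mx mul_scalar_mx => /colP/(_ (enum_rank i)).
  by rewrite !mxE enum_rankK.
exists (char_poly A); first exact: char_poly_monic.
have : \det D * 1 = 0.
  by rewrite c1E mulr_sumr big1 // => i _; rewrite mulrCA detG mulr0.
rewrite mulr1 rootE -horner_evalE -2!det_map_mx => /eqP; congr (\det _ == 0).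
rewrite /D raddfB /= map_scalar_mx; apply/matrixP => i j.
by rewrite !mxE raddfB raddfMn /= map_polyX map_polyC /horner_eval !hornerE.
Qed.

(** * The basis adapted to the subdiscriminants *)

Section Basis.
Variables (K : fieldType) (m k : nat).
Hypothesis km : (k < m)%N.
Hypothesis hchar : forall i : 'I_m, (m - k <= i)%N -> i.+1%:R != 0 :> K.
Hypothesis k_gt0 : (0 < k)%N.

Local Notation sD i := (sDiscPi K m (m - i.+1)).

(* Division with remainder of the exponent of ['X_i] by [i] (recall that      *)
(* ['X_i] is Pi_(i+1)) replaces the powers of ['X_i ^+ i] by powers of the    *)
(* subdiscriminant whose lowest term it is.                                   *)
Definition bfactor (i : 'I_m) (n : nat) : {mpoly K[m]} :=
  if (m - k <= i)%N then sD i ^+ (n %/ i) * 'X_i ^+ (n %% i) else 'X_i ^+ n.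

Definition bvec (e : 'X_{1..m}) : {mpoly K[m]} := \prod_(i < m) bfactor i (e i).

Lemma replaced_index_gt0 (i : 'I_m) : (m - k <= i)%N -> (0 < i)%N.
Proof. by apply: leq_trans; rewrite subn_gt0. Qed.

Lemma natr_dim_neq0 : m%:R != 0 :> K.
Proof.
have m_gt0 := leq_ltn_trans (leq0n k) km.
have lt_m : (m.-1 < m)%N by rewrite prednK.
have := @hchar (Ordinal lt_m); rewrite /= prednK //; apply.
by rewrite -subn1 leq_sub2l.
Qed.

Lemma bvec_lowest e : mlowest (@mnmwgt m) (@lexwt m) e (bvec e).
Proof.
rewrite {1}(multinomUE_id e) /bvec.
apply: (big_ind2 (mlowest (@mnmwgt m) (@lexwt m))) => [||i _].
- exact: mlowest1.
- by move=> e1 p1 e2 p2; apply: mlowestM.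
rewrite /bfactor; case: ifP => ki; last exact/mlowestXn/mlowestX.
rewrite {1}(divn_eq (e i) i).
have -> : (U_(i) *+ (e i %/ i * i + e i %% i))%MM =
    (U_(i) *+ i *+ (e i %/ i) + U_(i) *+ (e i %% i))%MM.
  by apply/mnmP => j; rewrite !(mnmDE, mulmnE) mulnDr (mulnC _ i) mulnA.
apply: mlowestM; last exact/mlowestXn/mlowestX.
by apply/mlowestXn/sDiscPi_lowest; [apply: natr_dim_neq0 | apply: hchar].
Qed.

Lemma bvec_id (e : 'X_{1..m}) : (forall i : 'I_m, (m - k <= i)%N -> (e i < i)%N) ->
  bvec e = 'X_[e].
Proof.
move=> small; rewrite mpolyXE_id; apply: eq_bigr => i _; rewrite /bfactor.
by case: ifP => // /small ei; rewrite divn_small // modn_small // mul1r.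
Qed.

Lemma bvecM (i : 'I_m) e : (m - k <= i)%N ->
  bvec (U_(i) *+ i + e) = sD i * bvec e.
Proof.
move=> ki; rewrite /bvec (bigD1 i) //= [in RHS](bigD1 i) //= mulrA.
congr (_ * _); last first.
  by apply: eq_bigr => j ji; rewrite mnmDE mulmnE mnm1E eq_sym (negbTE ji).
rewrite mnmDE mulmnE mnm1E eqxx mul1n /bfactor ki.
by rewrite divnDl // divnn (replaced_index_gt0 ki) modnDl exprS -mulrA.
Qed.

Lemma mlinext_bvecM (i : 'I_m) p : (m - k <= i)%N ->
  mlinext bvec ('X_[U_(i) *+ i] * p) = sD i * mlinext bvec p.
Proof.
move=> ki; rewrite [in LHS](mpolyE p) mulr_sumr raddf_sum [in RHS]/mlinext mulr_sumr.
apply: eq_bigr => e _; rewrite -scalerAr /= linearZ /= -mpolyXD mlinextX bvecM //.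
by rewrite scalerAr.
Qed.

Lemma mlinext_bvec_inj : injective (mlinext bvec).
Proof. exact/raddf_inj/mlinext_lowest_inj/bvec_lowest. Qed.

Lemma mlinext_bvec_surj p : exists q, mlinext bvec q = p.
Proof. exact/(mlinext_lowest_surj bvec_lowest)/lexwt_le. Qed.

Let n := (m - k)%N.
Let widen (i : 'I_n) : 'I_m := widen_ord (leq_subr k m) i.

Definition Pi_mnm (b : 'X_{1..n}) : 'X_{1..m} :=
  (\sum_(i < n) U_(widen i) *+ b i)%MM.

Lemma Pi_inclX b : Pi_incl 'X_[K, b] = 'X_[Pi_mnm b].
Proof.
rewrite /Pi_incl comp_mpolyX /Pi_mnm -mprodXnE; apply: eq_bigr => i _.
by rewrite tnth_mktuple mpolyXn.
Qed.

Lemma Pi_mnmE b (i : 'I_m) : Pi_mnm b i = 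
  if insub (i : nat) is Some j then b j else 0%N.
Proof.
rewrite /Pi_mnm mnm_sumE; case: insubP => [j _ ji|ni].
  rewrite (bigD1 j) //= big1 => [|l lj].
    by rewrite mulmnE mnm1E -val_eqE /= ji eqxx mul1n addn0.
  by rewrite mulmnE mnm1E -val_eqE /= -ji val_eqE (negbTE lj).
rewrite big1 // => l _; rewrite mulmnE mnm1E -val_eqE /=.
by case: eqP ni => // <-; rewrite ltn_ord.
Qed.

Lemma mlinext_bvec_Pi_incl (p : {mpoly K[n]}) :
  mlinext bvec (Pi_incl p) = Pi_incl p.
Proof.
have -> : Pi_incl p = \sum_(b <- msupp p) p@_b *: 'X_[Pi_mnm b].
  rewrite {1}[p]mpolyE raddf_sum; apply: eq_bigr => b _.
  by rewrite /= -Pi_inclX; apply: comp_mpolyZ.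
rewrite raddf_sum; apply: eq_bigr => b _ /=.
rewrite linearZ /= mlinextX bvec_id // => i ki.
rewrite Pi_mnmE insubN ?(replaced_index_gt0 ki) //.
by rewrite -leqNgt.
Qed.

Let retr_vars : m.-tuple {mpoly K[n]} :=
  [tuple (if insub (i : nat) is Some j then 'X_j else 0) | i < m].

(** A retraction of [Pi_incl] that sets Pi_r = 0 for r > m - k. *)
Definition Pi_retr (p : {mpoly K[m]}) : {mpoly K[n]} := p \mPo retr_vars.

HB.instance Definition _ := GRing.RMorphism.copy Pi_retr (comp_mpoly retr_vars).

Lemma Pi_retrXU (i : 'I_m) : Pi_retr 'X_i =
  if insub (i : nat) is Some j then 'X_j else 0.
Proof. by rewrite /Pi_retr comp_mpolyXU -tnth_nth tnth_mktuple. Qed.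

Lemma Pi_inclK : cancel (@Pi_incl K m k) Pi_retr.
Proof.
move=> p; suff Xb b : Pi_retr (Pi_incl 'X_[K, b]) = 'X_[b].
  have -> : Pi_incl p = \sum_(b <- msupp p) p@_b *: Pi_incl 'X_[b].
    rewrite {1}[p]mpolyE raddf_sum; apply: eq_bigr => b _.
    exact: comp_mpolyZ.
  rewrite [RHS]mpolyE raddf_sum; apply: eq_bigr => b _.
  by rewrite -[in RHS]Xb; apply: comp_mpolyZ.
rewrite /Pi_incl comp_mpolyX rmorph_prod [RHS]mpolyXE_id.
apply: eq_bigr => i _; rewrite rmorphXn /= tnth_mktuple Pi_retrXU /=.
by case: insubP => [j _ /val_inj ->|] //; rewrite ltn_ord.
Qed.

Lemma sDisc_ideal_Pi_incl (p : {mpoly K[n]}) :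
  sDisc_ideal k (Pi_incl p) -> p = 0.
Proof.
move=> /asboolP[c pE].
have ordP (j : 'I_k) : (m - j.+1 < m)%N by rewrite ltn_subrL /= (leq_ltn_trans _ km).
pose o j := Ordinal (ordP j).
have oE (j : 'I_k) : sDiscPi K m j = sD (o j).
  have jm := ltn_trans (ltn_ord j) km.
  by rewrite /o /= subnSK // subKn // ltnW.
have ko (j : 'I_k) : (m - k <= o j)%N by rewrite leq_sub2l.
have /fin_all_exists[d dE] (j : 'I_k) := mlinext_bvec_surj (c j).
(* Undoing [mlinext bvec] fixes the left side and replaces each subdiscriminant by its lowest
   monomial, which [Pi_retr] kills. *)
have : Pi_incl p = \sum_(j < k) 'X_[(U_(o j) *+ o j)%MM] * d j.
  apply: mlinext_bvec_inj; rewrite mlinext_bvec_Pi_incl pE raddf_sum /=.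
  by apply: eq_bigr => j _; rewrite mlinext_bvecM // dE oE mulrC.
move/(congr1 Pi_retr); rewrite Pi_inclK => ->.
rewrite raddf_sum big1 //= => j _; rewrite rmorphM -mpolyXn rmorphXn /= Pi_retrXU.
rewrite insubN; first by rewrite expr0n eqn0Ngt (replaced_index_gt0 (ko j)) mul0r.
by rewrite -leqNgt ko.
Qed.

End Basis.

(** [i.+1] is the factor of index m - (i + 1) in the falling factorial. *)
Lemma natf_ffact_neq0 (K : fieldType) (m k i : nat) :
    (forall p : nat, p \in [pchar K] -> ~~ (p %| m ^_ k)%N) ->
  (m - k <= i < m)%N -> i.+1%:R != 0 :> K.
Proof.
move=> hchar /andP[ki im]; apply/negP => i0.
have [p pK] := natf0_pchar (ltn0Sn i) i0.
have /negP[] := hchar p pK; apply: (@dvdn_trans i.+1).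
  by rewrite (dvdn_pcharf pK).
have jk : (m - i.+1 < k)%N by rewrite ltn_subLR // addSn ltnS addnC -leq_subLR.
rewrite ffact_prod (bigD1 (Ordinal jk)) //= subKn //.
exact: dvdn_mulr.
Qed.

(** * Injectivity and integrality of the map to the quotient *)

Section Integrality.
Variables (K : fieldType) (m k : nat) (hk : (1 <= k <= m - 1)%N).
Hypothesis hchar : forall i : 'I_m, (m - k <= i)%N -> i.+1%:R != 0 :> K.

Local Notation Q := {ideal_quot (sDisc_idealr K hk)}.
Let n := (m - k)%N.

Let k_gt0 : (0 < k)%N. Proof. by case/andP: hk. Qed.

Let km : (k < m)%N.
Proof.
by case/andP: hk => k1; rewrite subn1; case: (m) => //=; rewrite leqNgt k1.
Qed.

Lemma pi_eq0 (p : {mpoly K[m]}) : (\pi_Q p == 0) = sDisc_ideal k p.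
Proof.
rewrite -(rmorph0 \pi_Q); have := Quotient.idealrBE (sDisc_idealr K hk) p 0.
by rewrite subr0 => <-.
Qed.

Lemma pi_sDiscPi (j : nat) : (j < k)%N -> \pi_Q (sDiscPi K m j) = 0.
Proof.
move=> jk; apply/eqP; rewrite pi_eq0; apply/asboolP.
exists (fun j' => (j' == Ordinal jk)%:R).
rewrite (bigD1 (Ordinal jk)) //= eqxx mul1r big1 ?addr0 // => j' /negbTE ->.
by rewrite mul0r.
Qed.

(** Exponents below [m] suffice, as remainders modulo [i] are less than [i < m]. The family is
    larger than a basis, but only spanning matters. *)
Definition expo_mnm (a : {ffun 'I_m -> 'I_m}) : 'X_{1..m} :=
  [multinom (a i : nat) | i < m].

(** Either a subdiscriminant divides [bvec e], whose class is then 0, or [bvec e] is the monomial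
    itself, which splits into its parts in Pi_1, ..., Pi_(m-k) and in the remaining Pi's. *)
Lemma pi_bvec_span e :
  exists c : {ffun 'I_m -> 'I_m} -> {mpoly K[n]},
    \pi_Q (bvec K k e) = \sum_a Pi_to_quot hk (c a) * \pi_Q 'X_[expo_mnm a].
Proof.
have [/existsP[i /andP[ki ei]]|] :=
    boolP [exists i : 'I_m, (m - k <= i)%N && (i <= e i)%N].
  exists (fun=> 0); rewrite big1 => [|a _]; last by rewrite rmorph0 mul0r.
  have -> : e = (U_(i) *+ i + (e - U_(i) *+ i))%MM.
    rewrite addmC submK //; apply/mnm_lepP => j.
    by rewrite mulmnE mnm1E; case: eqP => [<-|_]; rewrite ?mul1n ?mul0n.
  rewrite bvecM // rmorphM /= pi_sDiscPi ?mul0r //.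
  by rewrite ltn_subLR // addSn ltnS addnC -leq_subLR.
rewrite negb_exists => /forallP small.
have {}small (i : 'I_m) : (m - k <= i)%N -> (e i < i)%N.
  by move=> ki; have := small i; rewrite ki /= -ltnNge.
rewrite bvec_id //.
have m_gt0 := leq_ltn_trans (leq0n k) km.
pose b : 'X_{1..n} := [multinom e (widen_ord (leq_subr k m) i) | i < n].
(* The default of [insubd] is never taken, because [e i < i < m]. *)
pose a : {ffun 'I_m -> 'I_m} :=
  [ffun i : 'I_m => if (m - k <= i)%N then insubd (Ordinal m_gt0) (e i)
             else Ordinal m_gt0].
exists (fun a' => (a' == a)%:R * 'X_[b]).
rewrite (bigD1 a) //= eqxx mul1r big1 ?addr0; last first.
  by move=> a' /negbTE ->; rewrite mul0r rmorph0 mul0r.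
rewrite /Pi_to_quot -rmorphM Pi_inclX -mpolyXD; congr (\pi_Q 'X_[_]).
apply/mnmP => i; rewrite mnmDE Pi_mnmE !mnmE ffunE.
case: insubP => [j lt_jn ji|]; rewrite -/n.
  rewrite leqNgt lt_jn /= addn0 mnmE; congr (e _); exact: val_inj.
rewrite -leqNgt => ki; rewrite ki add0n val_insubd.
by rewrite (ltn_trans (small i ki)).
Qed.

Lemma Pi_to_quot_integral : integralRange (@Pi_to_quot K m k hk).
Proof.
apply: (@integralRange_fin_span _ _ _ _ (fun a => \pi_Q 'X_[expo_mnm a])) => x.
pose span x := exists c : {ffun 'I_m -> 'I_m} -> {mpoly K[n]},
  x = \sum_a Pi_to_quot hk (c a) * \pi_Q 'X_[expo_mnm a].
rewrite -/(span x).
have spanD y z : span y -> span z -> span (y + z).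
  move=> [c ->] [d ->]; exists (fun a => c a + d a).
  by rewrite -big_split /=; apply: eq_bigr => a _; rewrite rmorphD mulrDl.
have [p pE] := mlinext_bvec_surj km hchar k_gt0 (repr x).
rewrite -[x]reprK -pE /mlinext raddf_sum; apply: big_ind => //.
  by exists (fun=> 0); rewrite big1 // => a _; rewrite rmorph0 mul0r.
move=> e _; have [c cE] := pi_bvec_span e.
exists (fun a => (p@_e)%:MP * c a).
transitivity (Pi_to_quot hk (p@_e)%:MP * \pi_Q (bvec K k e)).
  by rewrite /Pi_to_quot /Pi_incl comp_mpolyC -mul_mpolyC -[RHS]rmorphM.
rewrite cE mulr_sumr; apply: eq_bigr => a _.
by rewrite [in RHS]rmorphM mulrA.
Qed.

Lemma Pi_to_quot_inj : injective (@Pi_to_quot K m k hk).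
Proof.
apply: raddf_inj => p /eqP; rewrite pi_eq0.
exact: (sDisc_ideal_Pi_incl km hchar k_gt0).
Qed.

End Integrality.

Theorem theoremA1 (K : fieldType) (m k : nat) (hk : (1 <= k <= m - 1)%N)
    (hchar : forall p : nat, p \in [pchar K] -> ~~ (p %| m ^_ k)%N) :
  injective (@Pi_to_quot K m k hk) /\ integralRange (@Pi_to_quot K m k hk).
Proof.
have ichar (i : 'I_m) : (m - k <= i)%N -> i.+1%:R != 0 :> K.
  by move=> ki; apply: (natf_ffact_neq0 hchar); rewrite ki ltn_ord.
by split; [apply: Pi_to_quot_inj | apply: Pi_to_quot_integral].
Qed.
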